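(* Let $V_{\mathbf s}=(s_i^{j})_{i,j=0}^{n-1}$ be a nonsingular Vandermonde matrix with complex knots $s_0,\dots,s_{n-1}$. Let $s_+=\max_{0\le i\le n-1}|s_i|$ and $|V_{\mathbf s}|=\max\{1,s_+^{n-1}\}$. Then: (i) $\kappa(V_{\mathbf s})\ge \max\{1,\,s_+^{n-1}/\sqrt n\}$; (ii) if $\nu>1$ and $1\le k\le n$ are such that $1/|s_i|\ge\nu$ for $i=0,1,\dots,k-1$, then $$\kappa(V_{\mathbf s})\ge \frac{|V_{\mathbf s}|\,\nu^{k-1}}{\sqrt k\,\max\{k,\nu/(\nu-1)\}}.$$
   Context: $\kappa(M)=\|M\|\,\|M^{-1}\|$ for a nonsingular matrix $M$, where $\|\cdot\|$ is the spectral norm. The condition $1/|s_i|\ge\nu$ is understood as $|s_i|\le 1/\nu$ (so it holds when $s_i=0$). *)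

(* Defs.v *)
From mathcomp Require Import all_boot all_order all_algebra.
From mathcomp Require Import classical_sets reals.
From mathcomp Require Import complex.

Set Implicit Arguments.
Unset Strict Implicit.
Unset Printing Implicit Defensive.

Import Order.TTheory GRing.Theory Num.Theory.
Import ComplexField.

Local Open Scope classical_set_scope.
Local Open Scope ring_scope.
Local Open Scope complex_scope.

(* [Normc.normc] is the R-valued complex modulus, whereas the generic norm
   of R[i] takes its values in R[i]. *)
Definition l2norm (R : realType) (n : nat) (x : 'cV[R[i]]_n) : R :=
  Num.sqrt (\sum_(i < n) Normc.normc (x i 0) ^+ 2).

(* The closed unit ball, rather than the unit sphere, keeps the set nonempty
   in dimension 0. *)
Definition spectral_norm (R : realType) (m n : nat) (M : 'M[R[i]]_(m, n)) : R :=
  sup [set l2norm (M *m x) | x in [set x : 'cV[R[i]]_n | l2norm x <= 1]].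

(* Meaningful for nonsingular M only: [invmx M] is M itself when M is
   singular. *)
Definition condition_number (R : realType) (n : nat) (M : 'M[R[i]]_n) : R :=
  spectral_norm M * spectral_norm (invmx M).

(* The library's [Vandermonde] has the knots along the columns, with entry
   s_j ^ i at (i, j), hence the transposition. *)
Definition vandermonde_mx (R : realType) (n : nat) (s : 'rV[R[i]]_n) :
  'M[R[i]]_n := (Vandermonde n s)^T.

(* The default value 0 is harmless for n > 0, as moduli are nonnegative. *)
Definition max_knot (R : realType) (n : nat) (s : 'rV[R[i]]_n) : R :=
  \big[Num.max/0]_(i < n) Normc.normc (s 0 i).

(* The quantity |V_s|, which is not a norm of the matrix. *)
Definition vandermonde_size (R : realType) (n : nat) (s : 'rV[R[i]]_n) : R :=
  Num.max 1 (max_knot s ^+ n.-1).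

(* Main.v *)
(* Every entry of V bounds ||V|| from below, so |V_s| <= ||V||, while the first
   column of V has norm sqrt n and is the image of a unit vector, so
   ||V^-1|| >= 1 / sqrt n; this gives (i).  For (ii), some nonzero combination
   y of the first k rows of V vanishes in the columns 0, ..., k-2.  Put
   q = 1 / nu.  In a column j >= k-1 the combination is at most
   q^j sqrt k ||y|| by Cauchy-Schwarz, and summing the geometric series gives
   ||y V|| <= sqrt k ||y|| q^(k-1) / (1 - q).  Since ||y|| <= ||V^-1|| ||y V||,
   this bounds ||V^-1|| from below, even without the alternative k inside the
   maximum. *)
Require Import Defs.
From mathcomp Require Import all_boot all_order all_algebra.
From mathcomp Require Import classical_sets reals.
From mathcomp Require Import complex.
From mathcomp Require Import ring lra.

Import Order.TTheory GRing.Theory Num.Theory.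
Import ComplexField.

Local Open Scope ring_scope.
Local Open Scope complex_scope.

(** * Inequalities for finite sums *)

Lemma sum_sqr_ge0 (R : realDomainType) (I : finType) (a : I -> R) :
  0 <= \sum_i a i ^+ 2.
Proof. by apply: sumr_ge0 => i _; apply: sqr_ge0. Qed.

(** Lagrange's identity: the double sum of the squares of [a i * b j - a j * b i] is twice the right
    side minus the left side. *)
Lemma cauchy_schwarz_sum (R : realDomainType) (I : finType) (a b : I -> R) :
  (\sum_i a i * b i) ^+ 2 <= (\sum_i a i ^+ 2) * (\sum_i b i ^+ 2).
Proof.
have : 0 <= \sum_i \sum_j (a i * b j - a j * b i) ^+ 2.
  by apply: sumr_ge0 => i _; apply: sum_sqr_ge0.
have sqrB i j : (a i * b j - a j * b i) ^+ 2 =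
    a i ^+ 2 * b j ^+ 2 + b i ^+ 2 * a j ^+ 2 - 2 * (a i * b i * (a j * b j)).
  by ring.
under eq_bigr => i _ do under eq_bigr => j _ do rewrite sqrB.
under eq_bigr => i _ do rewrite sumrB big_split /= -[X in _ - X]mulr_sumr.
rewrite sumrB big_split /= -[X in _ - X]mulr_sumr -!big_distrlr /=.
by set A := \sum_i a i ^+ 2; set B := \sum_i b i ^+ 2; set C := \sum_i _; nra.
Qed.

Lemma sum_sqr_le_sqr_sum (R : realDomainType) (I : finType) (a : I -> R) :
  (forall i, 0 <= a i) -> \sum_i a i ^+ 2 <= (\sum_i a i) ^+ 2.
Proof.
move=> a_ge0; rewrite expr2 mulr_suml; apply: ler_sum => i _.
rewrite expr2 ler_wpM2l// (bigD1 i)//= lerDl.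
by apply: sumr_ge0.
Qed.

Lemma geometric_tail_le (R : realFieldType) (q : R) (m n : nat) :
  0 <= q < 1 -> \sum_(m <= j < n) q ^+ j <= q ^+ m / (1 - q).
Proof.
move=> /andP[q_ge0 q_lt1].
have [n_le|m_lt] := leqP n m.
  by rewrite big_geq// divr_ge0 ?exprn_ge0// subr_ge0 ltW.
(* Multiplied by [1 - q], the sum telescopes to [q ^+ m - q ^+ n]. *)
rewrite ler_pdivlMr ?subr_gt0// mulrC -[leLHS]opprK mulr_sumr -sumrN.
under eq_bigr do rewrite mulrBl mul1r -exprS opprB.
by rewrite telescope_sumr ?(ltnW m_lt)// opprB lerBlDr lerDl exprn_ge0.
Qed.

(** * The complex modulus *)

Section Modulus.
Variable R : rcfType.
Implicit Types x y : R[i].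

Lemma normc_ge0 x : 0 <= Normc.normc x.
Proof. by case: x => a b; apply: sqrtr_ge0. Qed.

Lemma normcX x n : Normc.normc (x ^+ n) = Normc.normc x ^+ n.
Proof.
by elim: n => [|n IH]; rewrite ?Normc.normc1// !exprS Normc.normcM IH.
Qed.

Lemma normc_sum_le (I : finType) (P : pred I) (F : I -> R[i]) :
  Normc.normc (\sum_(i | P i) F i) <= \sum_(i | P i) Normc.normc (F i).
Proof.
elim/big_ind2: _ => [|x1 x2 y1 y2 le1 le2|//].
  by rewrite Normc.normc0.
by apply: le_trans (le_normcD _ _) _; apply: lerD.
Qed.

Lemma mulc_conj x : x * x^* = (Normc.normc x ^+ 2)%:C.
Proof. by rewrite -sqr_normc rmorphXn. Qed.

Lemma normc_real (a : R) : 0 <= a -> Normc.normc a%:C = a.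
Proof. by move=> a_ge0; rewrite /= expr0n addr0 sqrtr_sqr ger0_norm. Qed.

Lemma normc_conj x : Normc.normc x^* = Normc.normc x.
Proof. by case: x => a b /=; rewrite sqrrN. Qed.

End Modulus.

(** * The Euclidean norm and the spectral norm *)

Section SpectralNorm.
Variable R : realType.

Lemma l2norm_ge0 n (x : 'cV[R[i]]_n) : 0 <= l2norm x.
Proof. exact: sqrtr_ge0. Qed.

Lemma sqr_l2norm n (x : 'cV[R[i]]_n) :
  l2norm x ^+ 2 = \sum_i Normc.normc (x i 0) ^+ 2.
Proof. by rewrite sqr_sqrtr// sum_sqr_ge0. Qed.

Lemma l2norm_conj n (x : 'cV[R[i]]_n) : l2norm (map_mx (fun z => z^*) x) = l2norm x.
Proof.
by congr Num.sqrt; apply: eq_bigr => i _; rewrite mxE normc_conj.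
Qed.

Lemma normc_le_l2norm n (x : 'cV[R[i]]_n) i : Normc.normc (x i 0) <= l2norm x.
Proof.
rewrite -ler_sqr ?nnegrE ?normc_ge0 ?l2norm_ge0// sqr_l2norm (bigD1 i)//= lerDl.
by apply: sumr_ge0 => j _; apply: sqr_ge0.
Qed.

Lemma l2norm_le_sum n (x : 'cV[R[i]]_n) : l2norm x <= \sum_i Normc.normc (x i 0).
Proof.
have sum_ge0 : 0 <= \sum_i Normc.normc (x i 0).
  by apply: sumr_ge0 => i _; apply: normc_ge0.
rewrite -ler_sqr ?nnegrE ?l2norm_ge0// sqr_l2norm.
by apply: sum_sqr_le_sqr_sum => i; apply: normc_ge0.
Qed.

Lemma l2normZ n (c : R[i]) (x : 'cV[R[i]]_n) :
  l2norm (c *: x) = Normc.normc c * l2norm x.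
Proof.
rewrite /l2norm; under eq_bigr do rewrite mxE Normc.normcM exprMn.
by rewrite -mulr_sumr sqrtrM ?sqr_ge0// sqrtr_sqr ger0_norm ?normc_ge0.
Qed.

Lemma l2norm0 n : l2norm (0 : 'cV[R[i]]_n) = 0.
Proof. by rewrite -(scale0r 0) l2normZ Normc.normc0 mul0r. Qed.

Lemma l2norm_gt0 n (x : 'cV[R[i]]_n) : x != 0 -> 0 < l2norm x.
Proof.
move=> x_neq0; rewrite lt_def l2norm_ge0 andbT; apply: contra x_neq0 => /eqP x0.
apply/eqP/matrixP => i j; rewrite ord1 mxE; apply: Normc.eq0_normc.
by apply/le_anti; rewrite normc_ge0 andbT -x0 normc_le_l2norm.
Qed.

Lemma l2norm_delta n (j : 'I_n) : l2norm (delta_mx j 0 : 'cV[R[i]]_n) = 1.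
Proof.
rewrite /l2norm (bigD1 j)//= big1 ?addr0 => [|i /negbTE ij]; last first.
  by rewrite mxE ij Normc.normc0 expr0n.
by rewrite mxE !eqxx Normc.normc1 expr1n sqrtr1.
Qed.

(** This crude constant serves to show that the set in [spectral_norm] is bounded above, so that its
    [sup] is a genuine upper bound. *)
Lemma l2norm_mul_bounded m n (M : 'M[R[i]]_(m, n)) (x : 'cV[R[i]]_n) :
  l2norm (M *m x) <= (\sum_i \sum_j Normc.normc (M i j)) * l2norm x.
Proof.
apply: le_trans (l2norm_le_sum _ _) _.
rewrite mulr_suml; apply: ler_sum => i _.
rewrite mxE mulr_suml; apply: le_trans (normc_sum_le _ _ _ _) _.
apply: ler_sum => j _; rewrite Normc.normcM.
by rewrite ler_wpM2l ?normc_ge0 ?normc_le_l2norm.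
Qed.

Lemma l2norm_mul_le m n (M : 'M[R[i]]_(m, n)) (x : 'cV[R[i]]_n) :
  l2norm (M *m x) <= spectral_norm M * l2norm x.
Proof.
have [->|x_neq0] := eqVneq x 0; first by rewrite mulmx0 !l2norm0 mulr0.
have x_gt0 := l2norm_gt0 _ _ x_neq0.
rewrite -ler_pdivrMr//; apply: ub_le_sup.
  exists (\sum_i \sum_j Normc.normc (M i j)) => _ [z /= z_le1 <-].
  apply: le_trans (l2norm_mul_bounded _ _ _ _) _; apply: ler_piMr => //.
  by apply: sumr_ge0 => i _; apply: sumr_ge0 => j _; apply: normc_ge0.
have inv_normc : Normc.normc ((l2norm x)^-1)%:C = (l2norm x)^-1.
  by rewrite normc_real// invr_ge0 l2norm_ge0.
(* The witness in the unit ball is [x] scaled to length 1. *)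
exists (((l2norm x)^-1)%:C *: x) => /=.
  by rewrite l2normZ inv_normc mulVf ?gt_eqF.
by rewrite -scalemxAr l2normZ inv_normc mulrC.
Qed.

Lemma spectral_norm_ge0 m n (M : 'M[R[i]]_(m, n)) : 0 <= spectral_norm M.
Proof.
(* A nonzero [M] has a column, hence a basis vector to test the norm on. For [M = 0] there may be
   none, as [n] may be 0, but the set of values is then [0] alone. *)
have [->|M_neq0] := eqVneq M 0; last first.
  have /existsP[x Mx] : [exists j, col j M != 0].
    apply: contraNT M_neq0; rewrite negb_exists => /forallP col0.
    by apply/eqP/matrixP => i j; have /negPn/eqP/colP/(_ i) := col0 j; rewrite !mxE.
  have := l2norm_mul_le _ _ M (delta_mx x 0).
  by rewrite l2norm_delta mulr1; apply: le_trans; apply: l2norm_ge0.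
rewrite /spectral_norm (_ : [set _ | _ in _]%classic = [set 0]%classic) ?sup1//.
apply/seteqP; split => [_ [x _ <-]|_ ->] /=; first by rewrite mul0mx l2norm0.
by exists 0; rewrite /= ?mulmx0 l2norm0 ?ler01.
Qed.

Lemma normc_le_spectral_norm m n (M : 'M[R[i]]_(m, n)) i j :
  Normc.normc (M i j) <= spectral_norm M.
Proof.
have := l2norm_mul_le _ _ M (delta_mx j 0); rewrite l2norm_delta mulr1.
apply: le_trans; rewrite -colE.
by have := normc_le_l2norm _ (col j M) i; rewrite mxE.
Qed.

(* With [w = M^T z], the square of the norm of [w] is the (bilinear) pairing of
   [z] with [M w^*], to which Cauchy-Schwarz applies. *)
Lemma l2norm_trmul_le m n (M : 'M[R[i]]_(m, n)) (z : 'cV[R[i]]_m) :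
  l2norm (M^T *m z) <= spectral_norm M * l2norm z.
Proof.
have [->|w_neq0] := eqVneq (M^T *m z) 0.
  by rewrite l2norm0 mulr_ge0 ?spectral_norm_ge0 ?l2norm_ge0.
set w := M^T *m z in w_neq0 *.
have w_gt0 := l2norm_gt0 _ _ w_neq0.
set u := M *m map_mx (fun x => x^*) w.
have pairing : (l2norm w ^+ 2)%:C = \sum_j z j 0 * u j 0.
  rewrite sqr_l2norm rmorph_sum /=.
  under eq_bigr do rewrite -mulc_conj {1}/w mxE mulr_suml.
  rewrite exchange_big /=; apply: eq_bigr => j _; rewrite mxE mulr_sumr.
  by apply: eq_bigr => i _; rewrite !mxE; ring.
have sqr_le : l2norm w ^+ 2 <= l2norm z * l2norm u.
  rewrite -(normc_real _ _ (sqr_ge0 (l2norm w))) pairing.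
  apply: le_trans (normc_sum_le _ _ _ _) _.
  under eq_bigr do rewrite Normc.normcM.
  rewrite -ler_sqr ?nnegrE ?mulr_ge0 ?l2norm_ge0//; last first.
    by apply: sumr_ge0 => j _; rewrite mulr_ge0 ?normc_ge0.
  by rewrite exprMn !sqr_l2norm cauchy_schwarz_sum.
have u_le : l2norm u <= spectral_norm M * l2norm w.
  by rewrite -(l2norm_conj _ w) l2norm_mul_le.
rewrite -(ler_pM2r w_gt0) -expr2; apply: le_trans sqr_le _.
rewrite mulrAC mulrC; exact: ler_wpM2r (l2norm_ge0 _ _) _ _ u_le.
Qed.

(** A basis vector [e] equals [M (M^-1 e)], so its length 1 is at most the product of the two
    norms. *)
Lemma condition_number_ge1 n (M : 'M[R[i]]_n.+1) :
  M \in unitmx -> 1 <= condition_number M.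
Proof.
move=> M_unit; rewrite -(l2norm_delta _ (@ord0 n)).
rewrite -{1}(mulKVmx M_unit (delta_mx _ _)).
apply: le_trans (l2norm_mul_le _ _ _ _) _.
rewrite ler_wpM2l ?spectral_norm_ge0//.
by have := l2norm_mul_le _ _ (invmx M) (delta_mx ord0 0); rewrite l2norm_delta mulr1.
Qed.

End SpectralNorm.

(** * Norms of a Vandermonde matrix and of its inverse *)

Section VandermondeNorms.
Variables (R : realType) (n : nat) (s : 'rV[R[i]]_n).
Local Notation V := (vandermonde_mx s).

Lemma max_knot_ge0 : 0 <= max_knot s.
Proof.
apply: (big_ind (fun x => 0 <= x)) => [|x y x_ge0 _|i _] //.
  by rewrite le_max x_ge0.
exact: normc_ge0.
Qed.

Lemma max_knot_attained : (0 < n)%N ->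
  exists i, max_knot s = Normc.normc (s 0 i).
Proof.
(* The default 0 of the maximum lies below every modulus, so some knot attains the maximum as soon
   as there is one. *)
move=> n_gt0; exists [arg max_(i > Ordinal n_gt0) Normc.normc (s 0 i)]%O.
by apply: (bigmax_eq_arg _ (Ordinal n_gt0)) => // i _; apply: normc_ge0.
Qed.

Lemma vandermonde_size_le_spectral_norm : (0 < n)%N ->
  vandermonde_size s <= spectral_norm V.
Proof.
move=> n_gt0; have [i knot_i] := max_knot_attained n_gt0.
have last_lt : (n.-1 < n)%N by rewrite prednK.
rewrite ge_max; apply/andP; split.
  have := normc_le_spectral_norm _ _ _ V i (Ordinal n_gt0).
  by rewrite !mxE expr0 Normc.normc1.
have := normc_le_spectral_norm _ _ _ V i (Ordinal last_lt).
by rewrite !mxE normcX -knot_i.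
Qed.

Lemma spectral_norm_invmx_vandermonde_ge : (0 < n)%N -> V \in unitmx ->
  (Num.sqrt n%:R)^-1 <= spectral_norm (invmx V).
Proof.
move=> n_gt0 V_unit; pose e : 'cV[R[i]]_n := delta_mx (Ordinal n_gt0) 0.
have l2norm_Ve : l2norm (V *m e) = Num.sqrt n%:R.
  rewrite -colE /l2norm; congr Num.sqrt.
  under eq_bigr do rewrite !mxE expr0 Normc.normc1 expr1n.
  by rewrite sumr_const card_ord.
have := l2norm_mul_le _ _ _ (invmx V) (V *m e).
rewrite mulKmx// l2norm_delta l2norm_Ve.
by rewrite -div1r ler_pdivrMr// sqrtr_gt0 ltr0n.
Qed.

(** This [y] holds the coefficients of the combination of the first [k] rows of [V], padded with
    zeros to length [n] so that [V^T] can be applied to it. *)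
Lemma exists_supported_power_relation k : (1 <= k <= n)%N ->
  exists y : 'cV[R[i]]_n, [/\ y != 0,
    (forall i : 'I_n, (k <= i)%N -> y i 0 = 0) &
    (forall j, (j < k.-1)%N -> \sum_i s 0 i ^+ j * y i 0 = 0)].
Proof.
move=> /andP[k_gt0 k_le_n].
(* The two kinds of columns express k-1 relations and n-k support conditions:
   n-1 linear equations on n unknowns. *)
pose B : 'M[R[i]]_(n, n.-1) :=
  \matrix_(i, j) if (j < k.-1)%N then s 0 i ^+ j else (i == j.+1 :> nat)%:R.
have : kermx B != 0.
  rewrite kermx_eq0 /row_free neq_ltn; apply/orP; left.
  by apply: leq_ltn_trans (rank_leq_col _) _; rewrite prednK// (leq_trans k_gt0).
move=> /rowV0Pn[y /sub_kermxP yB y_neq0].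
have {}yB (j : 'I_n.-1) : \sum_i y 0 i * B i j = 0.
  by have /rowP/(_ j) := yB; rewrite !mxE.
exists y^T; split; first by rewrite trmx_eq0.
(* The condition on row [i] sits in column [i.-1]: that index is at least [k.-1], and the only
   nonzero entry of the column is in row [i]. *)
- move=> i k_le_i.
  have j_lt : (i.-1 < n.-1)%N.
    by rewrite -!subn1 ltn_sub2r ?(leq_trans _ (ltn_ord i)) ?ltnS ?(leq_trans k_gt0).
  have := yB (Ordinal j_lt).
  rewrite mxE (bigD1 i)//= mxE /= ltnNge prednK; last exact: leq_trans k_gt0 k_le_i.
  rewrite -(leq_add2r 1) !addn1 !prednK ?k_le_i/= ?(leq_trans k_gt0)//.
  rewrite eqxx mulr1 big1 ?addr0// => i' neq; rewrite mxE /= ltnNge.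
  rewrite -(leq_add2r 1) !addn1 !prednK ?k_le_i/= ?(leq_trans k_gt0)//.
  by rewrite (_ : (_ == _) = false) ?mulr0//; apply/negbTE.
- move=> j j_lt.
  have j_lt_n : (j < n.-1)%N.
    by apply: leq_trans j_lt _; rewrite -!subn1 leq_sub2r.
  rewrite -[RHS](yB (Ordinal j_lt_n)); apply: eq_bigr => i _.
  by rewrite !mxE /= j_lt mulrC.
Qed.

Lemma spectral_norm_invmx_vandermonde_ge_small (nu : R) k :
  V \in unitmx -> 1 < nu -> (1 <= k <= n)%N ->
  (forall i : 'I_n, (i < k)%N -> Normc.normc (s 0 i) <= nu^-1) ->
  nu ^+ k.-1 / (Num.sqrt k%:R * (nu / (nu - 1))) <= spectral_norm (invmx V).
Proof.
move=> V_unit nu_gt1 k_bounds s_le.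
have nu_gt0 : 0 < nu by apply: lt_trans nu_gt1.
have [k_gt0 k_le_n] := andP k_bounds.
have [y [y_neq0 y_supp y_orth]] := exists_supported_power_relation _ k_bounds.
have y_gt0 := l2norm_gt0 _ _ _ y_neq0.
(* Cauchy-Schwarz against the indicator of the first [k] indices, whose norm is [Num.sqrt k%:R]. *)
have sum_y_le : \sum_(i < n | (i < k)%N) Normc.normc (y i 0)
                <= Num.sqrt k%:R * l2norm y.
  rewrite -ler_sqr ?nnegrE ?mulr_ge0 ?sqrtr_ge0 ?l2norm_ge0//; last first.
    by apply: sumr_ge0 => i _; apply: normc_ge0.
  have indicator (i : 'I_n) : (if (i < k)%N then Normc.normc (y i 0) else 0) =
      (i < k)%N%:R * Normc.normc (y i 0) by case: ifP; rewrite ?mul1r ?mul0r.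
  have sqr_indicator (i : 'I_n) :
      (i < k)%N%:R ^+ 2 = (if (i < k)%N then 1 else 0) :> R.
    by case: ifP; rewrite ?expr1n ?expr0n.
  rewrite exprMn sqr_sqrtr ?ler0n// sqr_l2norm big_mkcond /=.
  under eq_bigr do rewrite indicator.
  apply: le_trans (cauchy_schwarz_sum _ _ _ _) _.
  rewrite ler_wpM2r ?sum_sqr_ge0//.
  under eq_bigr do rewrite sqr_indicator.
  by rewrite -big_mkcond /= -(big_ord_widen _ (fun=> 1)) // sumr_const card_ord.
(* The relations kill the entries with [j < k.-1]; in the others each of the first [k] knots
   contributes a factor of modulus at most [nu^-1 ^+ j]. *)
have entry_le (j : 'I_n) : Normc.normc ((V^T *m y) j 0) <=
    if (k.-1 <= j)%N then nu^-1 ^+ j * (Num.sqrt k%:R * l2norm y) else 0.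
  rewrite mxE; under eq_bigr do rewrite !mxE.
  case: leqP => [_|/y_orth ->]; last by rewrite Normc.normc0.
  rewrite (bigID (fun i : 'I_n => (i < k)%N)) /= [X in _ + X]big1 ?addr0; last first.
    by move=> i; rewrite -leqNgt => /y_supp ->; rewrite mulr0.
  apply: le_trans (normc_sum_le _ _ _ _) _.
  apply: (@le_trans _ _ (nu^-1 ^+ j * \sum_(i < n | (i < k)%N) Normc.normc (y i 0))).
    rewrite mulr_sumr; apply: ler_sum => i /s_le si_le.
    rewrite Normc.normcM normcX ler_wpM2r ?normc_ge0//.
    by rewrite lerXn2r ?nnegrE ?normc_ge0 ?invr_ge0 ?(ltW nu_gt0).
  by rewrite ler_wpM2l// exprn_ge0// invr_ge0 ltW.
(* The Euclidean norm is at most the sum of the moduli, which is bounded by a geometric tail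
   starting at [k.-1]. *)
have image_le : l2norm (V^T *m y) <=
    nu^-1 ^+ k.-1 / (1 - nu^-1) * (Num.sqrt k%:R * l2norm y).
  apply: le_trans (l2norm_le_sum _ _ _) _.
  apply: le_trans (ler_sum _ (fun j _ => entry_le j)) _.
  rewrite -big_mkcond /= -mulr_suml ler_wpM2r ?mulr_ge0 ?sqrtr_ge0 ?l2norm_ge0//.
  rewrite -(big_mkord (fun j => (k.-1 <= j)%N) (fun j => nu^-1 ^+ j)).
  apply: le_trans (geometric_tail_le _ _ k.-1 n _); last first.
    by rewrite invr_ge0 ltW//= invf_lt1.
  by rewrite [leRHS](big_nat_widenl _ 0).
(* The transpose of [invmx V] sends [V^T *m y] back to [y], and the norm of [invmx V] bounds its
   transpose too. *)
have := l2norm_trmul_le _ _ _ (invmx V) (V^T *m y).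
rewrite trmx_inv mulKmx => [y_le|]; last by rewrite unitmx_tr.
have {y_le image_le} := le_trans y_le (ler_wpM2l (spectral_norm_ge0 _ _ _ _) image_le).
have sqrtk_gt0 : 0 < Num.sqrt k%:R :> R by rewrite sqrtr_gt0 ltr0n.
have nu1_gt0 : 0 < nu - 1 by rewrite subr_gt0.
(* The positive factor [l2norm y] cancels; what remains is rearranged by
   [1 / (1 - nu^-1) = nu / (nu - 1)]. *)
set N := spectral_norm _; rewrite !mulrA -[leLHS]mul1r ler_pM2r// exprVn.
rewrite ler_pdivrMr ?mulr_gt0 ?divr_gt0 ?invr_gt0//.
have nuX_gt0 : 0 < nu ^+ k.-1 by rewrite exprn_gt0.
rewrite (_ : N / _ / _ * _ = N * (Num.sqrt k%:R * (nu / (nu - 1))) / nu ^+ k.-1).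
  by rewrite ler_pdivlMr// mul1r !mulrA.
by field; rewrite !gt_eqF.
Qed.

End VandermondeNorms.

(** * The two lower bounds for the condition number *)

Theorem corollary3p1 (R : realType) (n : nat) (n_gt0 : (0 < n)%N)
    (s : 'rV[R[i]]_n) (V_unit : vandermonde_mx s \in unitmx) :
  Num.max 1 (max_knot s ^+ n.-1 / Num.sqrt n%:R)
    <= condition_number (vandermonde_mx s)
  /\
  (forall (nu : R) (k : nat),
     1 < nu -> (1 <= k <= n)%N ->
     (forall i : 'I_n, (i < k)%N -> Normc.normc (s 0 i) <= 1 / nu) ->
     vandermonde_size s * nu ^+ k.-1
       / (Num.sqrt k%:R * Num.max k%:R (nu / (nu - 1)))
     <= condition_number (vandermonde_mx s)).
Proof.
have size_le := vandermonde_size_le_spectral_norm _ _ s n_gt0.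
have knot_ge0 := exprn_ge0 n.-1 (max_knot_ge0 _ _ s).
split.
  rewrite ge_max; apply/andP; split.
    by case: n n_gt0 s V_unit {size_le knot_ge0} => // n' _ s;
      apply: condition_number_ge1.
  apply: ler_pM => //; first by rewrite invr_ge0 sqrtr_ge0.
    by apply: le_trans size_le; rewrite le_max lexx orbT.
  exact: spectral_norm_invmx_vandermonde_ge.
move=> nu k nu_gt1 k_bounds; rewrite div1r => s_le.
have nu_gt0 : 0 < nu by apply: lt_trans nu_gt1.
have ratio_gt0 : 0 < nu / (nu - 1) by rewrite divr_gt0 ?subr_gt0.
have sqrtk_gt0 : 0 < Num.sqrt k%:R :> R.
  by rewrite sqrtr_gt0 ltr0n; case/andP: k_bounds.
have nuX_ge0 : 0 <= nu ^+ k.-1 by rewrite exprn_ge0// ltW.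
have max_gt0 : 0 < Num.max k%:R (nu / (nu - 1)) by rewrite lt_max ratio_gt0 orbT.
(* The factor [vandermonde_size s] is charged to the norm of [V], the remaining quotient to that of
   [invmx V]. *)
rewrite -mulrA; apply: ler_pM => //.
- by rewrite le_max ler01.
- by rewrite divr_ge0// mulr_ge0 ?(ltW sqrtk_gt0) ?(ltW max_gt0).
apply: le_trans
  (spectral_norm_invmx_vandermonde_ge_small _ _ _ _ _ _ _ k_bounds s_le) => //.
(* The maximum is at least [nu / (nu - 1)], so the quotient with the maximum in its denominator is
   the smaller one. *)
rewrite ler_wpM2l// lef_pV2 ?posrE ?(pmulr_rgt0 _ sqrtk_gt0)//.
by rewrite ler_pM2l// le_max lexx orbT.
Qed.
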